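(* Let $k\geq 1$ be an integer and let $r\geq\dfrac{k^2}{2}\left(1+7\left(\dfrac{\ln k}{k}\right)^{1/3}\right)$. Then every $r$-regular digraph contains at least $k$ pairwise vertex-disjoint directed cycles whose lengths are pairwise different.
   Context: Digraphs are finite, without loops and without multiple arcs (two opposite arcs between the same pair of vertices are allowed). A digraph is $r$-regular if every vertex has in-degree $r$ and out-degree $r$. The length of a directed cycle is its number of vertices. *)

(* Defs.v *)
From mathcomp Require Import all_boot.

Set Implicit Arguments.
Unset Strict Implicit.
Unset Printing Implicit Defensive.

(* A digraph without multiple arcs on a finite vertex type V is an arc relation
   on V; [e u v] means that there is an arc from u to v.  No symmetry condition
   is imposed, so two opposite arcs may coexist. *)
Definition digraph (V : finType) (e : rel V) : Prop := irreflexive e.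

Definition indegree (V : finType) (e : rel V) (v : V) : nat :=
  #|[set u | e u v]|.

Definition outdegree (V : finType) (e : rel V) (v : V) : nat :=
  #|[set w | e v w]|.

Definition regular (r : nat) (V : finType) (e : rel V) : Prop :=
  forall v : V, indegree e v = r /\ outdegree e v = r.

(* The sequence of vertices of a directed cycle, in order, from an arbitrary
   starting vertex; its size is the length of the cycle.  [path.cycle] holds of
   the empty sequence, which is excluded here; in a loopless digraph the size is
   then at least 2, and size 2 corresponds to a pair of opposite arcs. *)
Definition dicycle (V : finType) (e : rel V) (c : seq V) : bool :=
  [&& c != [::], cycle e c & uniq c].

(* Main.v *)
Require Import Defs.
From Stdlib Require Import BinNums BinPos BinNat Nnat PeanoNat Pnat.
From mathcomp Require Import all_boot all_order all_algebra.
From mathcomp Require Import ring lra.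
From mathcomp Require Import boolp reals sequences exp.

Set Implicit Arguments.
Unset Strict Implicit.
Unset Printing Implicit Defensive.

Import Order.TTheory GRing.Theory Num.Theory.

(* A longest path ends at a vertex all of whose out-neighbours lie on the path, so
   a digraph of minimum out-degree d has cycles of d different lengths.  Hence it
   suffices to colour the vertices with k colours, indexed from 0, in such a way
   that every colour occurs and every vertex of colour i has more than i
   out-neighbours of colour i: one then chooses greedily a cycle in each colour
   class.  Such a colouring is obtained by giving each vertex independently the
   colour i with probability about a_i / r, where a_i exceeds i by enough, and
   applying the local lemma to the events that a vertex has too few out-neighbours
   of its own colour.  These have probability at most 1 / (3 (r^2 + r + 1)) by an
   exponential moment bound, and since in-degrees are r as well, each depends on
   at most r^2 + r others.  The choice of the a_i is analytic for k >= 16; for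
   k < 16 it is given by a table, whose verification is a computation with binary
   numbers. *)

(** * Cycles of distinct lengths *)

Definition has_disjoint_dicycles (k : nat) (V : finType) (e : rel V) : Prop :=
  exists C : 'I_k -> seq V,
    [/\ forall i, dicycle e (C i),
        forall i j, i != j -> [disjoint C i & C j]
      & forall i j, i != j -> size (C i) != size (C j)].

(** All out-neighbours in [U] of the end of a longest path inside [U] lie on that path. Each closes
    a cycle, distinct ones give distinct lengths, and there are more of them than entries of [F]. *)
Lemma dicycle_avoiding_sizes (V : finType) (e : rel V) (U : {set V}) (F : seq nat) :
  U != set0 ->
  (forall v, v \in U -> size F < #|[set u in U | e v u]|) ->
  exists c, [/\ dicycle e c, {subset c <= U} & size c \notin F].
Proof.
move=> /set0Pn[v0 v0U] deg.
pose path_of n := [exists s : n.-tuple V,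
  [&& uniq s, all (mem U) s & (if val s is x :: p then path e x p else false)]].
have path1 : exists n, path_of n.
  by exists 1; apply/existsP; exists [tuple v0]; rewrite /= v0U.
have path_le n : path_of n -> n <= #|V|.
  by case/existsP=> s /andP[us _]; rewrite -(size_tuple s) -(card_uniqP us) max_card.
case: (ex_maxnP path1 path_le) => n /existsP[[[|x p] /= sz]] //.
case/and3P=> us /(allP (s := x :: p)) sU pth max_n.
pose s := x :: p; pose z := last x p.
have zU : z \in U by apply: sU; apply: mem_last.
have on_path u : u \in U -> e z u -> u \in s.
  move=> uU ezu; apply/negPn/negP => us'.
  have /max_n : path_of n.+1; last by rewrite ltnn.
  have szr : size (rcons s u) == n.+1 by rewrite size_rcons eqSS.
  apply/existsP; exists (Tuple szr); apply/and3P; split.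
  - change (uniq (rcons s u)); by rewrite rcons_uniq us'.
  - change (all (mem U) (rcons s u)); rewrite all_rcons /= uU.
    by apply/(allP (s := s)).
  - by rewrite /= rcons_path pth.
pose N := [set u in U | e z u].
(* The length of the cycle closed by the arc from [z] to [u], which follows the path from [u] to its
   end. *)
pose len u := size s - index u s.
have len_inj : {in N &, injective len}.
  move=> u1 u2; rewrite !inE => /andP[U1 e1] /andP[U2 e2].
  have s1 := on_path _ U1 e1; have s2 := on_path _ U2 e2.
  have i1 := s1; have i2 := s2; rewrite -index_mem in i1; rewrite -index_mem in i2.
  rewrite /len => E; have {}E : index u1 s = index u2 s.
    by apply/eqP; rewrite -(eqn_add2l (size s - index u1 s)) {2}E !subnK // ltnW.
  by rewrite -(nth_index x s1) E nth_index.
have [u uN uF] : exists2 u, u \in N & len u \notin F.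
  apply/exists_inP; apply: contraLR (deg _ zU); rewrite negb_exists_in -leqNgt.
  move=> /forall_inP sub; rewrite -/N cardE -(size_map len).
  apply: uniq_leq_size.
    rewrite map_inj_in_uniq ?enum_uniq // => a b; rewrite !mem_enum.
    exact: len_inj.
  by move=> ? /mapP[a]; rewrite mem_enum => /sub /negPn ? ->.
move: uN; rewrite inE => /andP[uU ezu]; have us' := on_path _ uU ezu.
exists (drop (index u s) s); split; last by rewrite size_drop.
  have lti : index u s < size s by rewrite index_mem.
  rewrite /dicycle drop_uniq // (drop_nth x lti) nth_index //= andbT.
  rewrite rcons_path.
  have Es : s = take (index u s) s ++ u :: drop (index u s).+1 s.
    by rewrite -[LHS](cat_take_drop (index u s)) (drop_nth x lti) nth_index.
  have -> : last u (drop (index u s).+1 s) = z.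
    by rewrite /z -[last x p]/(last x s) [in RHS]Es last_cat.
  rewrite ezu andbT.
  have /(drop_sorted (index u s)) : sorted e s by [].
  by rewrite (drop_nth x lti) nth_index.
by move=> y /mem_drop; apply: sU.
Qed.

(** The classes are treated in increasing order: at class [i] exactly [i] lengths have been used,
    and these form the list [F] to avoid. *)
Lemma greedy_distinct_sizes (V : finType) (e : rel V) k (U : 'I_k -> {set V}) :
  (forall i j, i != j -> [disjoint U i & U j]) ->
  (forall (i : 'I_k) (F : seq nat), size F <= i ->
     exists c, [/\ dicycle e c, {subset c <= U i} & size c \notin F]) ->
  has_disjoint_dicycles k e.
Proof.
move=> dU H.
have [C [Csize CU uC]] : exists C : seq (seq V), [/\ size C = k,
    forall i : 'I_k, dicycle e (nth [::] C i) /\ {subset nth [::] C i <= U i} &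
    uniq (map size C)].
  suff: forall j, j <= k -> exists C : seq (seq V), [/\ size C = j,
    forall i : 'I_k, i < j ->
      dicycle e (nth [::] C i) /\ {subset nth [::] C i <= U i} &
    uniq (map size C)].
    case/(_ k (leqnn k)) => C [? CU ?]; exists C; split=> // i; exact: CU.
  elim=> [_|j IH ltj]; first by exists [::].
  have [C [Cj CU uC]] := IH (ltnW ltj).
  have [] := H (Ordinal ltj) (map size C); first by rewrite size_map Cj.
  move=> c [cyc cU cF]; exists (rcons C c); split.
  - by rewrite size_rcons Cj.
  - move=> i; rewrite ltnS leq_eqVlt nth_rcons Cj => /orP[/eqP ij|ij].
      by rewrite ij ltnn eqxx; split=> // y /cU; rewrite (_ : Ordinal ltj = i) //; apply: val_inj.
    by rewrite ij; apply: CU.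
  - by rewrite map_rcons rcons_uniq cF.
exists (fun i => nth [::] C i); split=> [i|i j ij|i j ij].
- by case: (CU i).
- have [_ Ci] := CU i; have [_ Cj] := CU j.
  by apply: disjointWl (introT subsetP Ci) _; apply: disjointWr (introT subsetP Cj) _; apply: dU.
- rewrite -!(nth_map _ 0 size) ?Csize // nth_uniq ?size_map ?Csize //.
Qed.

Local Open Scope ring_scope.

(** * The local lemma for random colourings *)

Section ProductMeasure.
Variables (R : realFieldType) (V I : finType) (w : I -> R).
Hypothesis w_ge0 : forall i, 0 <= w i.
Hypothesis w_sum1 : \sum_i w i = 1.

Definition mass (f : {ffun V -> I}) : R := \prod_v w (f v).

Definition prob (A : pred {ffun V -> I}) : R := \sum_(f | A f) mass f.

Definition depends_on (A : pred {ffun V -> I}) (S : {set V}) : Prop :=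
  forall f g : {ffun V -> I}, {in S, f =1 g} -> A f = A g.

Lemma mass_ge0 f : 0 <= mass f.
Proof. by apply: prodr_ge0. Qed.

Lemma prob_ge0 A : 0 <= prob A.
Proof. by apply: sumr_ge0 => f _; apply: mass_ge0. Qed.

Lemma sum_mass : \sum_f mass f = 1.
Proof.
rewrite /mass -(bigA_distr_bigA (fun _ i => w i)) /=.
by apply: big1 => v _.
Qed.

Lemma prob_sub (A B : pred {ffun V -> I}) :
  (forall f, A f -> B f) -> prob A <= prob B.
Proof.
move=> AB; rewrite /prob [leLHS]big_mkcond [leRHS]big_mkcond /=.
apply: ler_sum => f _; case: ifP => [/AB -> //|_].
by case: ifP => // _; apply: mass_ge0.
Qed.

Lemma eq_prob (A B : pred {ffun V -> I}) : A =1 B -> prob A = prob B.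
Proof. by move=> AB; apply: eq_bigl. Qed.

Lemma prob_exists (J : finType) (A : J -> pred {ffun V -> I}) :
  prob (fun f => [exists j, A j f]) <= \sum_j prob (A j).
Proof.
rewrite {1}/prob big_mkcond /=.
under [leRHS]eq_bigr => j _ do rewrite /prob big_mkcond.
rewrite exchange_big /=; apply: ler_sum => f _.
have F_ge0 j : 0 <= if A j f then mass f else 0.
  by case: ifP => // _; apply: mass_ge0.
case: existsP => [[j Aj]|_]; last exact: sumr_ge0.
by rewrite (bigD1 j) //= Aj lerDl sumr_ge0.
Qed.

Lemma prob_split (A B : pred {ffun V -> I}) :
  prob B = prob (fun f => A f && B f) + prob (fun f => ~~ A f && B f).
Proof.
rewrite /prob (bigID A) /=.
by congr (_ + _); apply: eq_bigl => f; rewrite andbC.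
Qed.

(* Two independent colourings f and g have the same joint law after their values
   outside S are exchanged. *)
Lemma prob_indep (A B : pred {ffun V -> I}) (S : {set V}) :
  depends_on A S -> depends_on B (~: S) ->
  prob (fun f => A f && B f) = prob A * prob B.
Proof.
move=> depA depB.
pose mix (f g : {ffun V -> I}) : {ffun V -> I} :=
  [ffun v => if v \in S then f v else g v].
pose swap (p : {ffun V -> I} * {ffun V -> I}) := (mix p.1 p.2, mix p.2 p.1).
have swapK : involutive swap.
  case=> f g; congr (_, _); apply/ffunP => v; rewrite !ffunE;
    by case: (v \in S).
rewrite /prob big_distrlr pair_big /= (reindex_inj (inv_inj swapK)) /=.
rewrite -[LHS]mulr1 -sum_mass big_distrlr pair_big /=.
apply: eq_big => [[f g]|[f g] _] /=.
  rewrite andbT; congr (_ && _).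
    by apply: depA => v vS; rewrite ffunE vS.
  by apply: depB => v; rewrite inE ffunE => /negbTE ->.
rewrite /mass -!big_split /=; apply: eq_bigr => v _; rewrite !ffunE.
by case: ifP => // _; rewrite mulrC.
Qed.

Section LocalLemma.
Variables (J : finType) (A : J -> pred {ffun V -> I}) (S : J -> {set V}).
Variables (d : nat) (x : R).
Hypothesis A_dep : forall j, depends_on (A j) (S j).
Hypothesis deg_le : forall j,
  (#|[set u | (u != j) && ~~ [disjoint S u & S j]]| <= d)%N.
Hypotheses (x_ge0 : 0 <= x) (x_le1 : x <= 1).
Hypothesis A_small : forall j, prob (A j) <= x * (1 - x) ^+ d.

Definition avoid (T : {set J}) : pred {ffun V -> I} :=
  fun f => [forall j in T, ~~ A j f].

Lemma avoidU1 j (T : {set J}) f : avoid (j |: T) f = ~~ A j f && avoid T f.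
Proof.
apply/forall_inP/andP => [H | [Aj /forall_inP H] u].
  by split; [apply: H; rewrite setU11|apply/forall_inP=> u uT; apply: H; rewrite setU1r].
by rewrite !inE => /orP[/eqP -> //|/H].
Qed.

(** Chain rule of the local lemma, written with products so that no conditioning on an event of
    probability zero can occur. Each event removed from [T1] costs a factor [1 - x]; the premise is
    the induction hypothesis of [prob_bad_avoid]. *)
Lemma prob_avoid_lower n :
  (forall j (T : {set J}), (#|T| < n)%N -> j \notin T ->
     prob (fun f => A j f && avoid T f) <= x * prob (avoid T)) ->
  forall T1 T2 : {set J}, [disjoint T1 & T2] -> (#|T1 :|: T2| <= n)%N ->
    (1 - x) ^+ #|T1| * prob (avoid T2) <= prob (avoid (T1 :|: T2)).
Proof.
move=> H T1 T2; have [m] := ubnP #|T1|; elim: m => // m IH in T1 *.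
rewrite ltnS => T1m dT le_n.
have [->|[j jT1]] := set_0Vmem T1; first by rewrite cards0 mul1r set0U.
have cT1 := cardsD1 j T1; rewrite jT1 add1n in cT1.
set U := (T1 :\ j) :|: T2.
have jU : j \notin U by rewrite !inE eqxx /= (disjointFr dT jT1).
have EU : T1 :|: T2 = j |: U by rewrite setUA setD1K.
have dU : [disjoint T1 :\ j & T2] by apply: disjointWl dT; apply: subD1set.
have cU : (#|U| < n)%N by move: le_n; rewrite EU cardsU1 jU.
rewrite cT1 exprS -mulrA EU.
apply: (@le_trans _ _ ((1 - x) * prob (avoid U))).
  apply: ler_wpM2l; first by rewrite subr_ge0.
  by apply: IH => //; [rewrite -cT1|apply: ltnW].
rewrite mulrBl mul1r lerBlDr {1}(prob_split (A j) (avoid U)) addrC.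
by rewrite (eq_prob (avoidU1 j U)) lerD2l H.
Qed.

(** The events of [T] that may interact with [A j] form [T1]. Once they are dropped, [A j] is
    independent of the rest; [prob_avoid_lower] restores them at the price of at most [d] factors
    [1 - x], which [A_small] provides. *)
Lemma prob_bad_avoid j (T : {set J}) : j \notin T ->
  prob (fun f => A j f && avoid T f) <= x * prob (avoid T).
Proof.
have [n] := ubnP #|T|; elim: n => // n IH in j T *; rewrite ltnS => Tn jT.
pose N := [set u | (u != j) && ~~ [disjoint S u & S j]].
pose T1 := T :&: N; pose T2 := T :\: N.
have ET : T = T1 :|: T2 by rewrite setID.
have dT : [disjoint T1 & T2].
  rewrite -setI_eq0; apply/eqP/setP => u; rewrite !inE.
  by case: (u \in T) => //=; case: (u != j) => //=; case: [disjoint _ & _].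
(* An event outside [N] is [j] itself, which is not in [T], or has a support disjoint from [S j]. *)
have dep2 : depends_on (avoid T2) (~: S j).
  move=> f g fg; rewrite /avoid; apply: eq_forallb_in => u.
  rewrite inE => /andP[uN uT].
  congr (~~ _); apply: A_dep => v vS; apply: fg.
  rewrite inE; apply: contraL uT => vSj; apply/negP => uT.
  move: uN; rewrite inE negb_and !negbK => /orP[/eqP uj|/disjointFr/(_ vS)].
    by rewrite -uj uT in jT.
  by rewrite vSj.
apply: (@le_trans _ _ (prob (fun f => A j f && avoid T2 f))).
  apply: prob_sub => f /andP[-> /forall_inP H] /=.
  by apply/forall_inP => u; rewrite inE => /andP[_ /H].
rewrite (prob_indep (@A_dep j) dep2).
apply: (@le_trans _ _ (x * (1 - x) ^+ d * prob (avoid T2))).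
  by apply: ler_wpM2r (A_small j); apply: prob_ge0.
rewrite -mulrA; apply: ler_wpM2l => //.
apply: (@le_trans _ _ ((1 - x) ^+ #|T1| * prob (avoid T2))).
  apply: ler_wpM2r; first exact: prob_ge0.
  apply: ler_wiXn2l; rewrite ?subr_ge0 ?gerBl //.
  by apply: leq_trans (deg_le j); apply: subset_leq_card; apply: subsetIr.
rewrite {1}ET; apply: (prob_avoid_lower (n := #|T|)) => //; last by rewrite -ET.
by move=> u U Ucard; apply: IH; apply: leq_trans Ucard Tn.
Qed.

Lemma local_lemma :
  (1 - x) ^+ #|J| <= prob (fun f => [forall j, ~~ A j f]).
Proof.
have := @prob_avoid_lower #|J| _ setT set0.
rewrite cardsT setU0 (_ : prob (avoid set0) = 1) ?mulr1; last first.
  rewrite -sum_mass; apply: eq_bigl => f; apply/forall_inP => u.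
  by rewrite inE.
rewrite (@eq_prob (avoid setT) (fun f => [forall j, ~~ A j f])); last first.
  by move=> f; apply: eq_forallb => j; rewrite inE.
apply; rewrite ?cardsT //; last by rewrite -setI_eq0 setI0.
by move=> j T _; apply: prob_bad_avoid.
Qed.

End LocalLemma.

Lemma prob_class_empty i :
  prob (fun f => [forall u, f u != i]) = (1 - w i) ^+ #|V|.
Proof.
have -> : 1 - w i = \sum_(c | c != i) w c.
  by rewrite -w_sum1 (bigD1 i) //= addrC addrK.
rewrite -prodr_const (eq_bigl predT) // bigA_distr_big_dep.
by apply: eq_bigl => f; apply: eq_forallb => u.
Qed.

(* Exponential moment bound: on the event, s ^+ m is at most s ^+ X, where X is
   the number of vertices of N coloured i. *)
Lemma prob_few_le (N : {set V}) v i (s : R) m : v \notin N -> 0 <= s <= 1 ->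
  prob (fun f => (f v == i) && (#|[set u in N | f u == i]| <= m)%N) * s ^+ m
  <= w i * (1 - w i * (1 - s)) ^+ #|N|.
Proof.
move=> vN /andP[s0 s1].
(* The product of all [h u (f u)] is the indicator of [f v = i] times [s ^+ X], so its expectation
   factors over the vertices. *)
pose h u c : R := if u == v then (c == i)%:R else
  if (u \in N) && (c == i) then s else 1.
have h0 u c : 0 <= h u c by rewrite /h; case: ifP => // _; case: ifP.
have sum_h u : \sum_c w c * h u c =
    if u == v then w i else if u \in N then 1 - w i * (1 - s) else 1.
  rewrite /h; case: ifP => _.
    rewrite (bigD1 i) //= eqxx mulr1 big1 ?addr0 // => c /negbTE ->.
    by rewrite mulr0.
  case: ifP => _ /=; last by rewrite -[RHS]w_sum1; apply: eq_bigr => c _; rewrite mulr1.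
  rewrite (bigD1 i) //= eqxx.
  rewrite (eq_bigr w) => [|c /negbTE ->]; last by rewrite mulr1.
  have -> : \sum_(c | c != i) w c = 1 - w i.
    by rewrite -w_sum1 [in RHS](bigD1 i) //= addrC addrK.
  by ring.
have -> : w i * (1 - w i * (1 - s)) ^+ #|N| =
    \sum_(f : {ffun V -> I}) \prod_u (w (f u) * h u (f u)).
  rewrite -(bigA_distr_bigA (fun u c => w c * h u c)) (bigD1 v) //= sum_h eqxx.
  congr (_ * _); rewrite -prodr_const big_mkcond [RHS]big_mkcond /=.
  apply: eq_bigr => u _; rewrite sum_h; case: eqP => [->|//].
  by rewrite (negbTE vN).
rewrite mulr_suml [leLHS]big_mkcond /=; apply: ler_sum => f _.
rewrite big_split /= -/(mass f).
have m0 := mass_ge0 f; case: ifP => [/andP[fv le_m]|_]; last first.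
  by apply: mulr_ge0 => //; apply: prodr_ge0.
apply: ler_wpM2l => //.
have -> : \prod_u h u (f u) = s ^+ #|[set u in N | f u == i]|.
  rewrite -prodr_const [RHS]big_mkcond /=; apply: eq_bigr => u _.
  rewrite /h inE; case: eqP => [->|//].
  by rewrite fv (negbTE vN).
exact: ler_wiXn2l.
Qed.
End ProductMeasure.

(** * Elementary bounds on the exponential *)

Lemma expR_le_inv (R : realType) (h : R) n :
  h < 1 -> expR (h * n%:R) <= (1 - h)^-1 ^+ n.
Proof.
move=> h1; rewrite expRM_natr; apply: lerXn2r; rewrite ?nnegrE ?expR_ge0 //.
  by rewrite invr_ge0 subr_ge0 ltW.
rewrite -(invrK (expR h)) -expRN lef_pV2 ?posrE ?expR_gt0 ?subr_gt0 //.
exact: expR_ge1Dx.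
Qed.

Lemma expR1_le3 (R : realType) : expR 1 <= 3 :> R.
Proof.
have := @expR_le_inv R (1 / 6) 6; rewrite divfK ?pnatr_eq0 // => H.
apply: (le_trans (H _)); first by lra.
have -> : (1 - 1 / 6)^-1 = 6 / 5 :> R by field.
by rewrite !exprS expr0; lra.
Qed.

(** For d >= 1 the right-hand side is (1 + 1/d)^(-d), hence at least 1/e. This is the origin of the
    factor 3 in the tail conditions. *)
Lemma inv3_le_pow (R : realType) d :
  3^-1 <= (1 - (d.+1%:R)^-1) ^+ d :> R.
Proof.
case: d => [|d]; first by rewrite expr0; lra.
have d0 : 0 < d.+1%:R :> R by rewrite ltr0n.
have -> : 1 - (d.+2%:R)^-1 = (1 + (d.+1%:R)^-1)^-1 :> R.
  have d2 : d.+2%:R = d.+1%:R + 1 :> R by rewrite -natr1.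
  rewrite d2; move: (d.+1%:R : R) d0 => D D0.
  by field; rewrite !lt0r_neq0 // addr_gt0.
rewrite exprVn lef_pV2 ?posrE ?exprn_gt0 ?addr_gt0 ?invr_gt0 //.
apply: le_trans (expR1_le3 R).
have -> : expR 1 = expR (d.+1%:R^-1) ^+ d.+1 :> R.
  by rewrite -expRM_natr mulVf ?lt0r_neq0.
apply: lerXn2r; rewrite ?nnegrE ?expR_ge0 ?expR_ge1Dx //.
by rewrite addr_ge0 ?invr_ge0 ?ltW.
Qed.

(** * Random colourings of a regular digraph *)

Section Colouring.
Variables (R : realType) (k r : nat) (V : finType) (e : rel V).
Variables (w s : 'I_k -> R).
Hypotheses (V_gt0 : (0 < #|V|)%N) (e_irr : digraph e) (e_reg : regular r e).
Hypotheses (w_ge0 : forall i, 0 <= w i) (w_sum1 : \sum_i w i = 1).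
Hypotheses (s01 : forall i, 0 <= s i <= 1) (k_le : (k <= r)%N).
(** Positivity is asked of the power rather than of [s i], because the table for small k takes s = 0
    for colour 0. *)
Hypothesis s_gt0 : forall i, 0 < s i ^+ i.
Hypothesis tail : forall i,
  (1 - w i * (1 - s i)) ^+ r * (3 * (r ^ 2 + r + 1)%:R) <= s i ^+ i.

Let N v : {set V} := [set u | e v u].
Let closed_N v : {set V} := v |: N v.
Let d := (r ^ 2 + r)%N.
Let x : R := (d.+1%:R)^-1.

Let N_card v : #|N v| = r.
Proof. by case: (e_reg v). Qed.

Let few (v : V) (i : 'I_k) : pred {ffun V -> 'I_k} :=
  fun f => (f v == i) && (#|[set u in N v | f u == i]| <= i)%N.

Let bad (v : V) : pred {ffun V -> 'I_k} := fun f => few v (f v) f.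

Let w_le1 i : w i <= 1.
Proof. by rewrite -w_sum1 (bigD1 i) //= lerDl sumr_ge0. Qed.

Let x_gt0 : 0 < x. Proof. by rewrite invr_gt0 ltr0n. Qed.

Let x_le1 : x <= 1. Proof. by rewrite invf_le1 ?ler1n ?ltr0n. Qed.

Let bound_ge i : (1 - w i * (1 - s i)) ^+ r <= x * (1 - x) ^+ d * s i ^+ i.
Proof.
apply: (@le_trans _ _ (x * 3^-1 * s i ^+ i)); last first.
  apply: ler_wpM2r; first exact: ltW.
  by apply: ler_wpM2l; [exact: ltW|exact: inv3_le_pow].
rewrite /x /d -addn1 -invfM [leRHS]mulrC ler_pdivlMr ?[_ * 3]mulrC //.
by rewrite mulr_gt0 // ltr0n addn1.
Qed.

Let factor_ge0 i : 0 <= 1 - w i * (1 - s i).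
Proof.
by have /andP[? ?] := s01 i; have := w_ge0 i; have := w_le1 i; nra.
Qed.

Let bad_dep v : depends_on (bad v) (closed_N v).
Proof.
move=> f g fg; rewrite /bad /few (fg v) ?setU11 //; congr (_ && (_ <= _)%N).
by apply: eq_card => u; rewrite !inE; case evu: (e v u) => //=; rewrite (fg u) // !inE evu orbT.
Qed.

(** If the closed out-neighbourhoods of [u] and [v] meet in [z], there are r + 1 choices for [z],
    and [u] is [z] or an in-neighbour of [z]. These r + 1 vertices include [v], which is excluded,
    so r choices of [u] remain. *)
Let bad_deg v :
  (#|[set u | (u != v) && ~~ [disjoint closed_N u & closed_N v]]| <= d)%N.
Proof.
pose T z := (z |: [set u | e u z]) :\ v.
have sub : [set u | (u != v) && ~~ [disjoint closed_N u & closed_N v]]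
    \subset \bigcup_(z in closed_N v) T z.
  apply/subsetP => u; rewrite inE => /andP[uv /pred0Pn[z /andP[/= zu zv]]].
  apply/bigcupP; exists z => //; rewrite !inE uv /=.
  by move: zu; rewrite !inE eq_sym.
apply: leq_trans (subset_leq_card sub) _.
have Tcard z : z \in closed_N v -> (#|T z| <= r)%N.
  move=> zv; have := cardsD1 v (z |: [set u | e u z]).
  have -> : v \in z |: [set u | e u z].
    by move: zv; rewrite !inE eq_sym.
  have -> : #|z |: [set u | e u z]| = r.+1.
    by rewrite cardsU1 inE (e_irr z) [#|_|](proj1 (e_reg z)).
  by rewrite add1n => -[<-].
apply: leq_trans (_ : (\sum_(z in closed_N v) r <= _)%N).
  elim/big_rec2: _ => [|z m A zv IH]; first by rewrite cards0.
  by apply: leq_trans (leq_card_setU _ _) _; rewrite leq_add ?Tcard.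
by rewrite sum_nat_const cardsU1 inE (e_irr v) N_card add1n mulSn addnC /d mulnn.
Qed.

(** Colour [i] contributes at most [w i] times the bound, and the weights sum to 1. *)
Let bad_small v : prob w (bad v) <= x * (1 - x) ^+ d.
Proof.
apply: (@le_trans _ _ (\sum_i prob w (few v i))).
  apply: le_trans (prob_exists w_ge0 _); apply: prob_sub => // f bad_f.
  by apply/existsP; exists (f v).
rewrite -[leRHS]mul1r -[X in _ <= X * _]w_sum1 mulr_suml; apply: ler_sum => i _.
rewrite -(ler_pM2r (s_gt0 i)).
apply: le_trans (prob_few_le w_ge0 w_sum1 i _ _ (s01 i)) _.
  by rewrite inE (e_irr v).
rewrite N_card -!mulrA; apply: ler_wpM2l => //; rewrite mulrA.
exact: bound_ge.
Qed.

Lemma good_colouring : exists f : {ffun V -> 'I_k},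
  (forall i, exists v, f v = i) /\
  forall v, (f v < #|[set u in N v | f u == f v]|)%N.
Proof.
have lll := local_lemma w_ge0 w_sum1 bad_dep bad_deg (ltW x_gt0) x_le1 bad_small.
pose empty i : pred {ffun V -> 'I_k} := fun f => [forall u, f u != i].
have empty_small : \sum_i prob w (empty i) < (1 - x) ^+ #|V|.
  have k_gt0 : (0 < k)%N.
    rewrite lt0n; apply/eqP => k0; move: w_sum1; rewrite big1 => [/eqP|[i lt_ik] _].
      by rewrite eq_sym oner_eq0.
    by have := lt_ik; rewrite [X in (_ < X)%N]k0.
  have r_gt0 : (0 < r)%N by apply: leq_trans k_le.
  have le_rd : (r <= d)%N by apply: leq_addl.
  have le_rn : (r <= #|V|)%N.
    by have /card_gt0P[v _] := V_gt0; rewrite -(N_card v) max_card.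
  have y_gt0 : 0 < 1 - x.
    by rewrite subr_gt0 invf_lt1 ?ltr0n // ltr1n ltnS (leq_trans r_gt0).
  (* Of the |V| factors [1 - w i], r of them yield the extra factor [x] by [b_r], and the others are
     bounded one by one by [b_le]. Summing over the colours then costs a factor k, and k x < 1. *)
  have class_small i : prob w (empty i) <= x * (1 - x) ^+ #|V|.
    rewrite prob_class_empty //.
    have b_ge0 : 0 <= 1 - w i by rewrite subr_ge0.
    have b_r : (1 - w i) ^+ r <= x * (1 - x) ^+ r.
      have /andP[s0 s1] := s01 i.
      apply: (@le_trans _ _ ((1 - w i * (1 - s i)) ^+ r)).
        apply: lerXn2r; rewrite ?nnegrE ?factor_ge0 // lerD2l lerN2.
        by rewrite -[leRHS]mulr1 ler_wpM2l // gerBl.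
      apply: le_trans (bound_ge i) _; rewrite -mulrA; apply: ler_wpM2l.
        exact: ltW.
      apply: (@le_trans _ _ ((1 - x) ^+ d * 1)).
        by rewrite ler_wpM2l ?exprn_ge0 ?(ltW y_gt0) ?exprn_ile1.
      by rewrite mulr1 ler_wiXn2l ?(ltW y_gt0) // gerBl ltW.
    have b_le : 1 - w i <= 1 - x.
      rewrite -(ler_pXn2r r_gt0) ?nnegrE ?(ltW y_gt0) //.
      by apply: le_trans b_r _; rewrite ler_piMl ?exprn_ge0 ?(ltW y_gt0).
    rewrite -(subnK le_rn) addnC !exprD mulrA.
    apply: ler_pM; rewrite ?exprn_ge0 //.
    by apply: lerXn2r; rewrite ?nnegrE ?(ltW y_gt0).
  apply: (@le_lt_trans _ _ (\sum_(i < k) x * (1 - x) ^+ #|V|)).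
    by apply: ler_sum => i _; apply: class_small.
  rewrite sumr_const card_ord -mulrnAl gtr_pMl ?exprn_gt0 //.
  rewrite -mulr_natl /x ltr_pdivrMr ?ltr0n // mul1r ltr_nat ltnS.
  exact: leq_trans k_le le_rd.
have [f good_f nonempty_f] : exists2 f, [forall v, ~~ bad v f] &
    [forall i, ~~ empty i f].
  apply/exists_inP; apply: contraTT isT => no_f.
  have : (1 - x) ^+ #|V| < (1 - x) ^+ #|V|; last by rewrite ltxx.
  apply: le_lt_trans lll _; apply: le_lt_trans empty_small.
  apply: le_trans (prob_exists w_ge0 _); apply: prob_sub => // f good_f.
  move: no_f; rewrite negb_exists => /forallP/(_ f); rewrite good_f /=.
  by rewrite negb_forall => /existsP[i]; rewrite negbK => ?; apply/existsP; exists i.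
exists f; split=> [i|v].
  have := forallP nonempty_f i; rewrite negb_forall => /existsP[v].
  by rewrite negbK => /eqP; exists v.
by have := forallP good_f v; rewrite /bad /few eqxx /= -ltnNge.
Qed.

Lemma disjoint_dicycles_of_weights : has_disjoint_dicycles k e.
Proof.
have [f [nonempty_f good_f]] := good_colouring.
apply: (@greedy_distinct_sizes _ _ _ (fun i => [set v | f v == i])).
  move=> i j ij; rewrite -setI_eq0; apply/eqP/setP => v; rewrite !inE.
  by case: eqP => // ->; apply: negbTE.
move=> i F F_le; apply: dicycle_avoiding_sizes.
  by have [v fv] := nonempty_f i; apply/set0Pn; exists v; rewrite inE fv.
move=> v; rewrite inE => /eqP fv; apply: leq_ltn_trans F_le _.
rewrite -fv; apply: leq_trans (good_f v) _; apply: subset_leq_card.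
by apply/subsetP => u; rewrite !inE => /andP[-> ->].
Qed.
End Colouring.

(** * Large k *)

(** The missing mass is spread evenly over the colours; larger weights only decrease the left side
    of the tail condition. *)
Lemma disjoint_dicycles_of_subweights (R : realType) (k r : nat) (V : finType)
    (e : rel V) (p s : 'I_k -> R) :
  (0 < #|V|)%N -> digraph e -> regular r e -> (0 < k <= r)%N ->
  (forall i, 0 <= p i) -> \sum_i p i <= 1 ->
  (forall i, 0 <= s i <= 1) -> (forall i, 0 < s i ^+ i) ->
  (forall i, (1 - p i * (1 - s i)) ^+ r * (3 * (r ^ 2 + r + 1)%:R) <= s i ^+ i) ->
  has_disjoint_dicycles k e.
Proof.
move=> V0 irr reg /andP[k0 kr] p0 p1 s01 s0 tail.
pose q := (1 - \sum_i p i) / k%:R.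
have q0 : 0 <= q by rewrite divr_ge0 ?subr_ge0.
have w0 i : 0 <= p i + q by rewrite addr_ge0.
have w1 : \sum_i (p i + q) = 1.
  by rewrite big_split sumr_const card_ord /= -mulr_natr divfK ?pnatr_eq0 -?lt0n // subrKC.
apply: (@disjoint_dicycles_of_weights R k r V e (fun i => p i + q) s) => // i.
apply: le_trans (tail i); apply: ler_wpM2r; first by rewrite mulr_ge0.
apply: lerXn2r; rewrite ?nnegrE.
- have w_le1 : p i + q <= 1 by rewrite -w1 (bigD1 i) //= lerDl sumr_ge0.
  by have /andP[? ?] := s01 i; have := w0 i; nra.
- have p_le1 : p i <= 1 by apply: le_trans p1; rewrite (bigD1 i) //= lerDl sumr_ge0.
  by have /andP[? ?] := s01 i; have := p0 i; nra.
- by have /andP[? ?] := s01 i; nra.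
Qed.

Lemma ln2_le (R : realType) : ln 2 <= 7 / 10 :> R.
Proof.
rewrite -ler_expR lnK ?posrE //.
have -> : 7 / 10 = 7 / 640 * 64%:R :> R by field.
rewrite expRM_natr; apply: (@le_trans _ _ ((1 + 7 / 640) ^+ 64)); first by lra.
by apply: lerXn2r; rewrite ?nnegrE ?expR_ge0 ?expR_ge1Dx //; lra.
Qed.

Lemma ln_ge1 (R : realType) (K : R) : 3 <= K -> 1 <= ln K.
Proof.
move=> K_ge; rewrite -ler_expR lnK ?posrE; last by lra.
exact: le_trans (expR1_le3 R) _.
Qed.

(** Tangent of [ln] at 16 together with 4 ln 2 <= 14/5; the slope 7/40 is 14/5 divided by 16. *)
Lemma ln_le_linear (R : realType) (K : R) : 16 <= K -> ln K <= 7 / 40 * K.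
Proof.
move=> K_ge; have {1}-> : K = 2 ^+ 4 * (1 + (K / 16 - 1)) by field.
rewrite lnM ?posrE; [|by lra|by lra].
have := @le_ln1Dx R (K / 16 - 1); rewrite lnXn // -mulr_natr.
by have := ln2_le R; lra.
Qed.

Lemma cbrt_cube (R : realType) (x : R) : 0 <= x -> (x `^ (1 / 3)) ^+ 3 = x.
Proof.
move=> x0; rewrite -powR_mulrn ?powR_ge0 // -powRrM div1r mulVf ?pnatr_eq0 //.
exact: powRr1.
Qed.

(** At r = rho it suffices that 6 rho^2 <= K^(11/2), which follows from rho <= 5/2 K^2 and K^(3/2)
    >= 64. For t = r / rho >= 1 the left side grows like t^2, which is at most exp((t - 1) L)
    because L >= 2. *)
Lemma tail_factor (R : realType) (r : nat) (K y rho : R) :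
  16 <= K -> 0 < y -> y <= 14 / 25 -> rho = K ^+ 2 / 2 * (1 + 7 * y) ->
  rho <= r%:R ->
  3 * (r ^ 2 + r + 1)%:R <= expR (r%:R / rho * (11 / 2 * ln K)).
Proof.
move=> K_ge y0 y_le rho_def rho_le; set L := 11 / 2 * ln K.
have L_ge2 : 2 <= L by have := @ln_ge1 R K; rewrite /L; lra.
have rho_ge : 128 <= rho by rewrite rho_def; nra.
have L_large : 6 * rho ^+ 2 <= expR L.
  pose u := expR (ln K / 2).
  have u2 : u ^+ 2 = K by rewrite -expRM_natr divfK ?pnatr_eq0 // lnK // posrE; lra.
  have u_ge0 : 0 <= u := expR_ge0 _.
  have u_ge4 : 4 <= u.
    by rewrite -(@ler_pXn2r _ 2) ?nnegrE // u2 expr2; lra.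
  have -> : expR L = u ^+ 11.
    by rewrite -expRM_natr; congr expR; rewrite /L; field.
  have -> : u ^+ 11 = u ^+ 3 * K ^+ 4 by rewrite -u2; ring.
  have u3 : 4 ^+ 3 <= u ^+ 3 by apply: lerXn2r; rewrite ?nnegrE.
  have K4 : 0 <= K ^+ 4 by apply: exprn_ge0; lra.
  apply: (@le_trans _ _ (4 ^+ 3 * K ^+ 4)); last exact: ler_wpM2r.
  apply: (@le_trans _ _ (6 * (5 / 2 * K ^+ 2) ^+ 2)); last by lra.
  apply: ler_wpM2l => //; apply: lerXn2r; rewrite ?nnegrE.
  - by lra.
  - by have := sqr_ge0 K; lra.
  - by rewrite rho_def; have := sqr_ge0 K; nra.
pose t := r%:R / rho.
have r_t : r%:R = t * rho by rewrite divfK // lt0r_neq0 //; lra.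
have t1 : 1 <= t by rewrite ler_pdivlMr ?mul1r //; lra.
have e_t : t ^+ 2 <= expR ((t - 1) * L).
  apply: (@le_trans _ _ (expR ((t - 1) * 2%:R))).
    rewrite expRM_natr; apply: lerXn2r; rewrite ?nnegrE ?expR_ge0 //; first by lra.
    by have := expR_ge1Dx (t - 1); lra.
  by rewrite ler_expR; apply: ler_wpM2l; lra.
have -> : r%:R / rho * L = L + (t - 1) * L by rewrite -/t; ring.
rewrite expRD; apply: (@le_trans _ _ (6 * rho ^+ 2 * t ^+ 2)); last first.
  by apply: ler_pM => //; [have := sqr_ge0 rho; lra|exact: sqr_ge0].
rewrite -mulrA -exprMn (mulrC rho) -r_t !natrD natrX.
by have : 128 <= r%:R :> R by [lra]; nra.
Qed.

Lemma sum_ord_le (R : realFieldType) n : \sum_(i < n) i%:R <= n%:R ^+ 2 / 2 :> R.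
Proof.
elim: n => [|n IH]; first by rewrite big_ord0 expr0n mul0r.
by rewrite big_ord_recr /= -natr1; lra.
Qed.

Lemma disjoint_dicycles_of_large (R : realType) (k r : nat)
    (V : finType) (e : rel V) :
  (16 <= k)%N ->
  k%:R ^+ 2 / 2 * (1 + 7 * (ln k%:R / k%:R) `^ (1 / 3)) <= r%:R :> R ->
  (0 < #|V|)%N -> digraph e -> regular r e -> has_disjoint_dicycles k e.
Proof.
move=> k_ge + V0 irr reg.
set K : R := k%:R; set y := _ `^ _; set rho := (X in X <= _) => rho_le.
have K_ge : 16 <= K by rewrite ler_nat.
have lnK1 : 1 <= ln K by apply: ln_ge1; lra.
have y3 : y ^+ 3 = ln K / K by apply: cbrt_cube; apply: divr_ge0; lra.
have y0 : 0 < y by apply: powR_gt0; apply: divr_gt0; lra.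
(* The cube of 14/25 lies just above 7/40. *)
have y_le : y <= 14 / 25.
  rewrite -(@ler_pXn2r _ 3) ?nnegrE ?(ltW y0) //; last by lra.
  by rewrite y3 ler_pdivrMr; have := ln_le_linear K_ge; lra.
have tail := tail_factor K_ge y0 y_le (erefl rho) rho_le.
set L := 11 / 2 * ln K in tail.
have L_eq : L = 11 / 2 * K * y ^+ 3 by rewrite y3 /L; field; lra.
have rho_ge : K ^+ 2 / 2 <= rho by rewrite /rho; nra.
have rho0 : 0 < rho by nra.
clearbody y.
(* Let t = 3 y = 4 eta.  Then exp (- t) <= s and a (1 - s) >= t, so that the choice
   of p makes the tail at most s ^+ i * exp (- L r / rho), while the power 4 keeps s
   close enough to exp (- t) for the sum of the p i to be at most 1. *)
pose eta := 3 / 4 * y; pose s := (1 + eta) ^- 4.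
pose a := 1 + 9 / 4 * y.
pose p (i : 'I_k) := a / (3 * y) * (3 * y * i%:R + L) / rho.
have L0 : 0 <= L by rewrite /L; lra.
have eta0 : 0 < eta by rewrite /eta; lra.
have E1 : 1 <= (1 + eta) ^+ 4 by apply: exprn_ege1; lra.
have s0 : 0 < s by rewrite invr_gt0; lra.
have s1 : s <= 1 by rewrite invf_le1 //; lra.
have kr : (k <= r)%N.
  by rewrite -(ler_nat R); apply: le_trans rho_le; rewrite -/K; nra.
have p0 i : 0 <= p i.
  rewrite /p; apply: divr_ge0; last exact: ltW.
  apply: mulr_ge0; first by apply: divr_ge0; rewrite /a; lra.
  by have := ler0n R i; rewrite addr_ge0 // mulr_ge0 //; lra.
(* After division by K^2 the claim is a (1/2 + 11/6 y^2) <= (1 + 7 y) / 2. The coefficient 7 of the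
   threshold is spent here, the higher powers of [y] being controlled by [y_le]. *)
have p1 : \sum_i p i <= 1.
  rewrite -mulr_suml -mulr_sumr big_split sumr_const card_ord /= -mulr_sumr.
  rewrite ler_pdivrMr // mul1r -[L *+ k]mulr_natl -/K.
  have := sum_ord_le R k; rewrite -/K; move: (\sum_(i < k) _) => S S_le.
  have -> : a / (3 * y) * (3 * y * S + K * L) = a * (S + 11 / 6 * K ^+ 2 * y ^+ 2).
    by rewrite L_eq; field; lra.
  have a_ge0 : 0 <= a by rewrite /a; lra.
  apply: (@le_trans _ _ (K ^+ 2 * (a * (1 / 2 + 11 / 6 * y ^+ 2)))).
    by have := ler_wpM2l a_ge0 S_le; lra.
  have -> : rho = K ^+ 2 * ((1 + 7 * y) / 2) by rewrite /rho; field.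
  apply: ler_wpM2l; first exact: sqr_ge0.
  have y2 : y ^+ 2 <= 14 / 25 * y by nra.
  have y3' : y ^+ 3 <= 14 / 25 * (14 / 25) * y by rewrite exprS; nra.
  by rewrite /a; lra.
have ps (i : 'I_k) : (3 * y * i%:R + L) / rho <= p i * (1 - s).
  (* In terms of [eta] this is (1 + 3 eta) ((1 + eta)^4 - 1) >= 4 eta (1 + eta)^4, and the two sides
     differ by eta^2 (2 - 2 eta - 3 eta^2 - eta^3). *)
  have a_s : 3 * y <= a * (1 - s).
    have eta_le : eta <= 21 / 50 by rewrite /eta; lra.
    have -> : 1 - s = ((1 + eta) ^+ 4 - 1) / (1 + eta) ^+ 4.
      by rewrite /s; field; apply: lt0r_neq0; lra.
    rewrite mulrA ler_pdivlMr; last by lra.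
    have -> : 3 * y = 4 * eta by rewrite /eta; lra.
    have -> : a = 1 + 3 * eta by rewrite /a /eta; lra.
    have eta2 : eta ^+ 2 <= 21 / 50 * eta by nra.
    have eta3 : eta ^+ 3 <= 21 / 50 * (21 / 50) * eta by rewrite exprS; nra.
    have : 0 <= 2 - 2 * eta - 3 * eta ^+ 2 - eta ^+ 3 by lra.
    by move=> /(mulr_ge0 (sqr_ge0 eta)); lra.
  have -> : p i * (1 - s) =
      a * (1 - s) / (3 * y) * ((3 * y * i%:R + L) / rho).
    by rewrite /p; field; rewrite !lt0r_neq0.
  rewrite ler_peMl //; last by rewrite ler_pdivlMr ?mul1r //; lra.
  by apply: divr_ge0; [apply: addr_ge0 => //; apply: mulr_ge0 => //|]; lra.
have p_le1 i : p i <= 1.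
  by apply: le_trans p1; rewrite (bigD1 i) //= lerDl sumr_ge0.
have ps1 i : p i * (1 - s) <= 1.
  by have := p0 i; have := p_le1 i; nra.
apply: (@disjoint_dicycles_of_subweights R k r V e p (fun=> s)) => //.
- by rewrite kr (leq_trans _ k_ge).
- by move=> i; rewrite (ltW s0).
- by move=> i; rewrite exprn_gt0.
move=> i.
have tau1 : 1 <= r%:R / rho by rewrite ler_pdivlMr ?mul1r.
(* The second exponential absorbs the polynomial factor by [tail_factor]; its exponent then cancels
   the part of the first one that contains [L]. *)
apply: (@le_trans _ _ (expR (- (3 * y * i%:R) - r%:R / rho * L) *
   expR (r%:R / rho * L))).
  apply: ler_pM => //; [|by rewrite mulr_ge0|].
    by apply: exprn_ge0; have := ps1 i; lra.
  apply: (@le_trans _ _ (expR (- (p i * (1 - s)) * r%:R))).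
    rewrite expRM_natr; apply: lerXn2r; rewrite ?nnegrE ?expR_ge0 ?expR_ge1Dx //.
    by have := ps1 i; lra.
  rewrite ler_expR mulNr -opprD lerN2.
  apply: (@le_trans _ _ ((3 * y * i%:R + L) / rho * r%:R)); last first.
    by apply: ler_wpM2r => //; apply: ps.
  have -> : (3 * y * i%:R + L) / rho * r%:R =
      3 * y * i%:R * (r%:R / rho) + r%:R / rho * L by ring.
  rewrite lerD2r ler_peMr //; apply: mulr_ge0 => //; lra.
rewrite -expRD subrK.
have -> : - (3 * y * i%:R) = - eta * (4 * i)%:R.
  by rewrite natrM /eta; field.
rewrite expRM_natr exprM /s -exprVn.
have eta_inv : expR (- eta) <= (1 + eta)^-1.
  by rewrite expRN lef_pV2 ?posrE ?expR_gt0 ?expR_ge1Dx //; lra.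
have inv_ge0 : 0 <= (1 + eta)^-1 by rewrite invr_ge0; lra.
by do 2![apply: lerXn2r; rewrite ?nnegrE ?exprn_ge0 ?expR_ge0 //].
Qed.

(** * Small k *)

(** From n to n + 1 the polynomial grows by 2n + 2, and z n >= 2 makes the factor [1 - z] outweigh
    this. Thus one test at [r0] covers every larger r. *)
Lemma tail_mono (R : realFieldType) (z : R) (r0 r : nat) :
  0 <= z <= 1 -> 2 <= z * r0%:R -> (r0 <= r)%N ->
  (1 - z) ^+ r * (r ^ 2 + r + 1)%:R <= (1 - z) ^+ r0 * (r0 ^ 2 + r0 + 1)%:R.
Proof.
move=> /andP[z0 z1] zr0 /subnK <-; elim: (r - r0)%N => [|j IH] //.
apply: le_trans IH; rewrite addSn; set n := (j + r0)%N.
rewrite exprSr -mulrA; apply: ler_wpM2l; first by apply: exprn_ge0; lra.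
have zn : 2 <= z * n%:R by apply: le_trans zr0 _; rewrite ler_wpM2l // ler_nat leq_addl.
have E m : (m ^ 2 + m + 1)%:R = m%:R ^+ 2 + m%:R + 1 :> R.
  by rewrite !natrD natrX.
rewrite !E -[n.+1%:R]natr1; move: (n%:R : R) (ler0n R n) zn => t t0 zt.
by have := ler_wpM2r t0 zt; lra.
Qed.

(** * Binary fixed-point arithmetic with upper bounds *)

Section FixedPoint.
Variables (R : realType).

Definition toR (a : N) : R := (N.to_nat a)%:R.

Lemma toR_ge0 a : 0 <= toR a.
Proof. exact: ler0n. Qed.

Lemma toRD a b : toR (N.add a b) = toR a + toR b.
Proof. by rewrite /toR N2Nat.inj_add plusE natrD. Qed.

Lemma toRM a b : toR (N.mul a b) = toR a * toR b.
Proof. by rewrite /toR N2Nat.inj_mul multE natrM. Qed.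

Lemma toRX a n : toR (N.pow a n) = toR a ^+ N.to_nat n.
Proof.
rewrite /toR N2Nat.inj_pow; elim: (N.to_nat n) => [|m IH] //.
by rewrite exprS -IH -natrM.
Qed.

Lemma toR_lt a b : N.ltb a b -> toR a < toR b.
Proof.
rewrite /N.ltb N2Nat.inj_compare.
by case: Nat.compare_spec => // /ssrnat.ltP; rewrite /toR ltr_nat.
Qed.

Lemma toR_le a b : N.leb a b -> toR a <= toR b.
Proof.
move=> /N.leb_le /N.lt_eq_cases [/N.ltb_lt/toR_lt/ltW //|-> //].
Qed.

Lemma toR_eq a b : N.eqb a b -> toR a = toR b.
Proof. by move=> /N.eqb_eq ->. Qed.

(* Fixed-point arithmetic with unit S^-1, every product being rounded up. *)
Variable S : N.
Hypothesis S_gt0 : 0 < toR S.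

Definition mul_up (a b : N) : N := N.succ (N.div (N.mul a b) S).

Fixpoint pow_up (b : N) (n : positive) : N :=
  match n with
  | xH => b
  | xO n' => let c := pow_up b n' in mul_up c c
  | xI n' => let c := pow_up b n' in mul_up b (mul_up c c)
  end.

(** A number [a] encodes the upper bound a / S; the successor of the truncated quotient exceeds the
    exact one. *)
Lemma mul_upP (x y : R) a b : 0 <= x -> 0 <= y ->
  x * toR S <= toR a -> y * toR S <= toR b -> x * y * toR S <= toR (mul_up a b).
Proof.
move=> x0 y0 xa yb; rewrite -(ler_pM2l S_gt0).
apply: (@le_trans _ _ (toR a * toR b)).
  have -> : toR S * (x * y * toR S) = (x * toR S) * (y * toR S) by ring.
  by apply: ler_pM => //; apply: mulr_ge0 => //; apply: ltW.
rewrite -!toRM; apply/ltW/toR_lt/N.ltb_lt.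
apply: N.mul_succ_div_gt => S0; move: S_gt0.
by rewrite S0 /toR ltxx.
Qed.

Lemma pow_upP (x : R) b n : 0 <= x -> x * toR S <= toR b ->
  x ^+ Pos.to_nat n * toR S <= toR (pow_up b n).
Proof.
move=> x0 xb; elim: n => [n IH|n IH|] /=; last by rewrite expr1.
  rewrite Pos2Nat.inj_xI exprS multE mulnC exprM expr2.
  by do 2?[apply: mul_upP]; rewrite ?mulr_ge0 ?exprn_ge0.
rewrite Pos2Nat.inj_xO multE mulnC exprM expr2.
by apply: mul_upP; rewrite ?exprn_ge0.
Qed.
End FixedPoint.

(** * Table of weights for 2 <= k <= 15 *)

Section Certificates.
Local Open Scope N_scope.

Definition cert_scale : N := 10 ^ 30.

(* The colour m has probability A / 1000, and the moment bound is used with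
   s = B / 1000, close to the optimal value m / (r p). *)
Definition cert_s (r A m : N) : N := m * 1000 * 1000 / (r * A).

(* The third test, p (1 - s) r >= 2, makes the tail bound persist for larger r. *)
Definition check_tail (r : positive) (A m : N) : bool :=
  let D := 1000 in
  let B := cert_s (Npos r) A m in
  let C := D - B in
  let U := D * D - A * C in
  [&& N.eqb (B + C) D, N.eqb (U + A * C) (D * D),
      N.leb (2 * (D * D)) (A * C * Npos r), N.ltb 0 (B ^ m) &
      N.leb (3 * (Npos r * Npos r + Npos r + 1) *
             pow_up cert_scale (U * 10 ^ 24) r * D ^ m)
            (B ^ m * cert_scale)].

(* If r0 - 1 reached the threshold, then ln k <= G^3 / (343 k^5) = G^3 / E * 256,
   hence k <= (E / (E - G^3))^256 by exp h <= (1 - h)^-1; this is refuted. *)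
Definition check_threshold (k r0 : N) : bool :=
  let G := 2 * r0 - (k * k + 2) in
  let E := 343 * k ^ 5 * 256 in
  let F := E - G ^ 3 in
  [&& N.eqb (G + (k * k + 2)) (2 * r0), N.eqb (F + G ^ 3) E, N.ltb 0 F &
      N.ltb (pow_up cert_scale (N.succ (E * cert_scale / F)) 256)
            (k * cert_scale)].

Definition check (k : nat) (c : N * seq N) : bool :=
  if c is (Npos r0, l) then
  [&& check_threshold (N.of_nat k) (Npos r0), size l == k,
      N.leb (foldr N.add 0 l) 1000 &
      all (fun m => check_tail r0 (nth 0 l m) (N.of_nat m)) (iota 0 k)]
  else false.

(* The entry (r0, l) at index i serves k = i + 2: l lists the numerators A of the
   probabilities, whose sum is at most 1000, and r0 bounds r from below. *)
Definition certificates : seq (N * seq N) := [::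
   (12, [:: 402; 574]);
   (28, [:: 244; 338; 403]);
   (48, [:: 169; 230; 273; 311]);
   (73, [:: 125; 168; 198; 225; 249]);
   (100, [:: 99; 131; 155; 175; 194; 211]);
   (135, [:: 78; 103; 121; 137; 151; 165; 178]);
   (170, [:: 65; 86; 100; 113; 125; 136; 146; 156]);
   (215, [:: 54; 71; 82; 93; 102; 111; 120; 128; 136]);
   (260, [:: 46; 60; 70; 79; 87; 94; 101; 108; 115; 121]);
   (315, [:: 40; 51; 60; 67; 74; 80; 86; 92; 97; 103; 108]);
   (370, [:: 35; 45; 52; 58; 64; 69; 75; 80; 84; 89; 94; 98]);
   (425, [:: 31; 40; 46; 52; 57; 61; 66; 70; 75; 79; 83; 87; 91]);
   (490, [:: 28; 35; 41; 46; 50; 54; 58; 62; 66; 69; 73; 76; 80; 83]);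
   (555, [:: 25; 32; 37; 41; 45; 49; 52; 56; 59; 62; 65; 68; 71; 74; 77])
  ].

Lemma certificates_ok :
  all (fun i => check i.+2 (nth (0, [::]) certificates i)) (iota 0 14).
Proof. by vm_compute. Qed.
End Certificates.

(** * Soundness of the table *)

Lemma toR_of_nat (R : realType) n : toR R (N.of_nat n) = n%:R.
Proof. by rewrite /toR Nat2N.id. Qed.

Lemma cert_scale_gt0 (R : realType) : 0 < toR R cert_scale.
Proof. by rewrite /cert_scale toRX exprn_gt0 // ltr0n. Qed.

(** With p = A / D and s = B / D, the base 1 - p (1 - s) equals U / D^2, so clearing denominators
    leaves the inequalities tested on integers. *)
Lemma tail_of_scaled (R : realFieldType) (A B C D U c : R) (r m : nat) :
  0 < D -> 0 <= B -> 0 <= C -> 0 <= A -> 0 <= U ->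
  B + C = D -> U + A * C = D * D -> 2 * (D * D) <= A * C * r%:R -> 0 < B ^+ m ->
  c * (U / (D * D)) ^+ r * D ^+ m <= B ^+ m ->
  exists s,
    [/\ 0 <= s <= 1, 0 < s ^+ m, 0 <= 1 - A / D * (1 - s) <= 1,
        2 <= A / D * (1 - s) * r%:R &
        (1 - A / D * (1 - s)) ^+ r * c <= s ^+ m].
Proof.
move=> D0 B0 C0 A0 U0 BC UAC big Bm tail; exists (B / D).
have Dn0 := lt0r_neq0 D0; have DD := mulr_gt0 D0 D0.
have sE : 1 - B / D = C / D by rewrite -(divff Dn0) -mulrBl -{1}BC addrAC subrr add0r.
have zE : 1 - A / D * (1 - B / D) = U / (D * D).
  by rewrite sE mulf_div -(divff (lt0r_neq0 DD)) -mulrBl -{1}UAC addrK.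
split.
- by rewrite (divr_ge0 B0 (ltW D0)) ler_pdivrMr // mul1r -BC lerDl.
- by rewrite exprMn mulr_gt0 // exprn_gt0 // invr_gt0.
- rewrite zE (divr_ge0 U0 (ltW DD)) ler_pdivrMr // mul1r -UAC.
  by rewrite lerDl mulr_ge0.
- by rewrite sE mulf_div mulrAC ler_pdivlMr.
- by rewrite zE [leRHS]expr_div_n ler_pdivlMr ?exprn_gt0 // (mulrC _ c).
Qed.

Lemma check_tailP (R : realType) r A m (p := toR R A / toR R 1000) :
  check_tail r A (N.of_nat m) -> exists s,
    [/\ 0 <= s <= 1, 0 < s ^+ m, 0 <= 1 - p * (1 - s) <= 1,
        2 <= p * (1 - s) * (Pos.to_nat r)%:R &
        (1 - p * (1 - s)) ^+ Pos.to_nat r *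
          (3 * (Pos.to_nat r ^ 2 + Pos.to_nat r + 1)%:R) <= s ^+ m].
Proof.
rewrite /check_tail; set B := cert_s _ _ _; set C := N.sub _ _; set U := N.sub _ _.
have S0 := cert_scale_gt0 R.
have SE : toR R cert_scale = toR R 1000 * toR R 1000 * toR R (10 ^ 24)%num.
  by rewrite -2!toRM; congr (toR R _).
(* Both powers of ten become variables tied only by [SE], which makes [U * M] the exact encoding of
   U / D^2. *)
move: cert_scale (10 ^ 24)%num => S M in S0 SE *.
(* The first two tests ensure that the truncated subtractions defining [C] and [U] are exact. *)
case/and5P=> /(toR_eq R) BC /(toR_eq R) UAC /(toR_le R) big /(toR_lt R) B0 /(toR_le R).
rewrite !(toRM, toRD, toRX) Nat2N.id in BC UAC big B0 *.
rewrite -[toR R (Npos r)]/((Pos.to_nat r)%:R) in big *.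
rewrite -[toR R 1]/1 -[toR R 3]/3.
rewrite -[toR R 2]/2 in big; rewrite -[toR R N0]/0 in B0.
have D0 : 0 < toR R 1000 by rewrite ltr0n.
have DD := mulr_gt0 D0 D0.
have := @pow_upP R _ S0 (toR R U / (toR R 1000 * toR R 1000)) (U * M)%num r.
rewrite divr_ge0 ?toR_ge0 ?(ltW DD) // toRM {1}SE mulrA divfK ?lt0r_neq0 //.
move=> /(_ isT (lexx _)) pw tail.
apply: (@tail_of_scaled _ _ (toR R B) (toR R C) _ (toR R U)); rewrite ?toR_ge0 //.
rewrite -(ler_pM2r S0); apply: le_trans tail.
set c := 3 * _; rewrite [in leRHS](_ : 3 * _ = c); last first.
  by rewrite /c !natrD natrX.
rewrite -!mulrA [_ * toR R S]mulrC !mulrA.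
apply: ler_wpM2r; first by apply: exprn_ge0; apply: ltW.
by rewrite -mulrA; apply: ler_wpM2l => //; rewrite mulr_ge0.
Qed.

(** The threshold gives 7 K^2 y <= G, where y is the cube root. Cubing yields 343 K^5 ln K <= G^3,
    that is ln K <= 256 (1 - F / E), and [expR_le_inv] bounds the exponential. *)
Lemma le_pow_of_threshold (R : realType) (K r G E F : R) :
  1 <= K -> K ^+ 2 / 2 * (1 + 7 * (ln K / K) `^ (1 / 3)) <= r ->
  2 * r <= G + K * K -> 0 <= G -> E = 343 * K ^+ 5 * 256 -> F + G ^+ 3 = E ->
  0 < F -> K <= (E / F) ^+ 256.
Proof.
move=> K1 thr r_le G0 EE FE F0.
have := @cbrt_cube R (ln K / K); set y := _ `^ _ in thr * => y3.
have y_ge0 : 0 <= y by apply: powR_ge0.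
have lnE : ln K = y ^+ 3 * K.
  by rewrite y3 ?divr_ge0 ?ln_ge0 ?divfK // ?lt0r_neq0 //; lra.
clearbody y.
have yG : 7 * K ^+ 2 * y <= G by lra.
have yG3 : (7 * K ^+ 2 * y) ^+ 3 <= G ^+ 3.
  apply: lerXn2r; rewrite ?nnegrE //.
  by apply: mulr_ge0 => //; have := sqr_ge0 K; lra.
have K5 : 0 < K ^+ 5 by apply: exprn_gt0; lra.
have E0 : 0 < E by lra.
rewrite -[leLHS]lnK ?posrE; last by lra.
apply: (@le_trans _ _ (expR ((1 - F / E) * 256%:R))).
  rewrite ler_expR; have -> : 1 - F / E = G ^+ 3 / E.
    by rewrite -(divff (lt0r_neq0 E0)) -mulrBl -{1}FE addrAC subrr add0r.
  by rewrite mulrAC ler_pdivlMr // lnE EE; lra.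
have := @expR_le_inv R (1 - F / E) 256.
by rewrite subKr invf_div; apply; rewrite gtrBl divr_gt0.
Qed.

Lemma check_thresholdP (R : realType) k r0 r : (0 < k)%N ->
  check_threshold (N.of_nat k) (Npos r0) ->
  k%:R ^+ 2 / 2 * (1 + 7 * (ln k%:R / k%:R) `^ (1 / 3)) <= r%:R :> R ->
  (Pos.to_nat r0 <= r)%N.
Proof.
move=> k_gt0; rewrite /check_threshold.
set G := (2 * _ - _)%num; set E := (343 * _ * 256)%num; set F := (E - _)%num.
have S0 := cert_scale_gt0 R; move: cert_scale S0 => S S0.
case/and4P=> /(toR_eq R) GE /(toR_eq R) FE /(toR_lt R) F0 /(toR_lt R) lt_k thr.
have EE : toR R E = 343 * k%:R ^+ 5 * 256 by rewrite 2!toRM toRX toR_of_nat.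
have K1 : 1 <= k%:R :> R by rewrite ler1n.
rewrite !(toRD, toRM) toR_of_nat in GE lt_k.
rewrite toRD toRX -[N.to_nat 3]/3%N in FE.
rewrite -[toR R 2]/2 -[toR R (Npos r0)]/((Pos.to_nat r0)%:R) in GE.
rewrite -[toR R N0]/0 in F0.
rewrite leqNgt; apply/negP => lt_r.
(* Here r <= r0 - 1, while [GE] says that G = 2 (r0 - 1) - k^2. *)
have r_le : 2 * r%:R <= toR R G + k%:R * k%:R.
  have : r%:R + 1 <= (Pos.to_nat r0)%:R :> R by rewrite natr1 ler_nat.
  move: (toR R G) ((Pos.to_nat r0)%:R : R) (k%:R : R) (r%:R : R) GE => g s K t.
  by lra.
have K_le := le_pow_of_threshold K1 thr r_le (toR_ge0 R G) EE FE F0.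
have EF0 : 0 <= toR R E / toR R F by rewrite divr_ge0 ?toR_ge0.
have := @pow_upP R _ S0 _ (N.succ (E * S / F)) 256 EF0.
have E_le : toR R E / toR R F * toR R S <= toR R (N.succ (E * S / F)).
  rewrite mulrAC ler_pdivrMr // [leRHS]mulrC -!toRM.
  apply/ltW/toR_lt/N.ltb_lt; apply: N.mul_succ_div_gt => F00.
  by move: F0; rewrite F00 ltxx.
move=> /(_ E_le) /le_lt_trans /(_ lt_k).
by rewrite ltr_pM2r // ltNge K_le.
Qed.

Lemma disjoint_dicycles_of_small (R : realType) (k r : nat)
    (V : finType) (e : rel V) :
  (1 < k < 16)%N ->
  k%:R ^+ 2 / 2 * (1 + 7 * (ln k%:R / k%:R) `^ (1 / 3)) <= r%:R :> R ->
  (0 < #|V|)%N -> digraph e -> regular r e -> has_disjoint_dicycles k e.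
Proof.
case: k => [|[|k]] //= k16 thr V0 irr reg.
have /allP/(_ k) := certificates_ok; rewrite mem_iota /= => /(_ k16).
rewrite /check; case: (nth _ _ _) => -[|r0] // l.
case/and4P=> /(check_thresholdP (ltn0Sn _))/(_ thr) le_r /eqP sz /(toR_le R) sum_l.
move=> /allP tails.
pose A (i : 'I_k.+2) := nth N0 l i.
pose p i := toR R (A i) / toR R 1000.
have D0 : 0 < toR R 1000 by rewrite ltr0n.
have in_iota (i : 'I_k.+2) : val i \in iota 0 k.+2 by rewrite mem_iota ltn_ord.
have [s sP] := boolp.choice (fun i => check_tailP R (tails _ (in_iota i))).
have p0 i : 0 <= p i by rewrite divr_ge0 ?toR_ge0 // ltW.
have kr : (k.+2 <= r)%N.
  rewrite -(ler_nat R); apply: le_trans thr.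
  have : 0 <= (ln k.+2%:R / k.+2%:R) `^ (1 / 3) :> R by apply: powR_ge0.
  have : 2 <= k.+2%:R :> R by rewrite ler_nat.
  by set y := _ `^ _; move: y (k.+2%:R : R) => y K; nra.
apply: (@disjoint_dicycles_of_subweights R k.+2 r V e p s) => //.
- rewrite -mulr_suml ler_pdivrMr // mul1r; apply: le_trans sum_l.
  have -> : toR R (foldr N.add N0 l) = \sum_(a <- l) toR R a.
    elim: l {sz tails A p s sP p0} => [|a l IH]; first by rewrite big_nil.
    by rewrite big_cons -IH -toRD.
  by rewrite (big_nth N0) sz big_mkord.
- by move=> i; case: (sP i).
- by move=> i; case: (sP i).
move=> i; have [_ _ z01 zr tl] := sP i.
(* The table was tested at [r0] only; with the factor 3 set aside, [tail_mono] carries the bound to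
   r. *)
apply: le_trans tl; rewrite mulrCA [leRHS]mulrCA; apply: ler_wpM2l => //.
by apply: tail_mono => //; move: z01; rewrite -/(p i); lra.
Qed.

Theorem theorem3p10 (R : realType) (k r : nat) (hk : (1 <= k)%N)
    (hr : k%:R ^+ 2 / 2 * (1 + 7 * (ln k%:R / k%:R) `^ (1 / 3)) <= r%:R :> R)
    (V : finType) (e : rel V) (hV : (0 < #|V|)%N)
    (he : digraph e) (hreg : regular r e) :
  exists C : 'I_k -> seq V,
    [/\ forall i, dicycle e (C i),
        forall i j, i != j -> [disjoint C i & C j]
      & forall i j, i != j -> size (C i) != size (C j)].
Proof.
have [k_ge|k_lt] := leqP 16 k; first exact: disjoint_dicycles_of_large hr _ _ _.
have [k_gt1|k_le1] := ltnP 1 k.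
  by apply: disjoint_dicycles_of_small hr _ _ _; rewrite ?k_gt1.
(* For k = 1 a single cycle suffices: the only class is the whole vertex set, no length is
   forbidden, and the threshold forces r > 0. *)
have k1 : k = 1 by apply/eqP; rewrite eqn_leq k_le1.
have r_gt0 : (0 < r)%N.
  rewrite lt0n; apply/eqP => r0; move: hr; rewrite r0 k1.
  by set y := _ `^ _; have : 0 <= y := powR_ge0 _ _; move: y => y; lra.
apply: (@greedy_distinct_sizes _ _ _ (fun=> setT)).
  by rewrite k1 => i j; rewrite !ord1 eqxx.
move=> i F F_le; apply: dicycle_avoiding_sizes.
  by rewrite -card_gt0 cardsT.
move=> v _; rewrite (_ : [set _ in _ | _] = [set w | e v w]).
  have i_lt := ltn_ord i; rewrite [X in (_ < X)%N]k1 ltnS leqn0 in i_lt.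
  have [_] := hreg v; rewrite /outdegree => ->.
  by apply: leq_ltn_trans F_le _; rewrite (eqP i_lt).
by apply/setP => w; rewrite !inE.
Qed.
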